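(* Let $p\ge1$ be an integer, let $\lambda>0$ be a real number, and let $G$ be a connected graph belonging to $\mathbf{W}_p$ which is $\lambda$-quasi-regularizable, with $n=n(G)$ and $\alpha=\alpha(G)$. Let $I(G;x)=\sum_{k=0}^{\alpha}s_kx^k$ be its independence polynomial. Define $$L=\left\lfloor\frac{p\alpha-1}{p+1}\right\rfloor,\qquad R=\left\lceil\frac{n-1}{\lambda+2}\right\rceil.$$ Then $$s_0\le s_1\le\cdots\le s_{L+1},\qquad s_R\ge s_{R+1}\ge\cdots\ge s_\alpha.$$ In particular, if $R\le L+1$, then $I(G;x)$ is unimodal.
   Context: All graphs are finite, undirected and simple. $V(G)$ is the vertex set, $n(G)=|V(G)|$, and $\alpha(G)$ is the maximum cardinality of an independent set of $G$. A maximum independent set is an independent set of cardinality $\alpha(G)$. The empty set is an independent set. For $A\subseteq V(G)$ the open neighborhood is $N_G(A)=\{v\in V(G)\setminus A : uv\in E(G)\text{ for some }u\in A\}$. For an integer $p\ge1$, a graph $G$ belongs to $\mathbf{W}_p$ if $n(G)\ge p$ and, for every $p$ pairwise disjoint independent sets $A_1,\ldots,A_p$ of $G$ (possibly empty), there exist $p$ pairwise disjoint maximum independent sets $S_1,\ldots,S_p$ of $G$ such that $A_i\subseteq S_i$ for every $i$. For a real number $\lambda>0$, a graph $G$ is $\lambda$-quasi-regularizable if $\lambda|A|\le|N_G(A)|$ for every independent set $A$ of $G$. The independence polynomial of $G$ is $I(G;x)=\sum_{k=0}^{\alpha(G)}s_kx^k$, where $s_k$ is the number of independent sets of $G$ of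 cardinality $k$. It is unimodal if there is an index $0\le t\le\alpha(G)$ such that $s_0\le\cdots\le s_{t-1}\le s_t\ge s_{t+1}\ge\cdots\ge s_{\alpha(G)}$. The chain $s_R\ge s_{R+1}\ge\cdots\ge s_\alpha$ means $s_k\ge s_{k+1}$ for every integer $k$ with $R\le k\le\alpha-1$; it is vacuous when $R\ge\alpha$. *)

(* Defs.v *)
From HB Require Import structures.
From mathcomp Require Import all_boot all_order all_algebra.
From mathcomp Require Import reals.

Set Implicit Arguments.
Unset Strict Implicit.
Unset Printing Implicit Defensive.

Import Order.TTheory GRing.Theory Num.Theory.

Local Open Scope ring_scope.

Record sgraph := SGraph {
  vertex :> finType;
  adj : rel vertex;
  adj_sym : symmetric adj;
  adj_irr : irreflexive adj }.

Section Graph.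
Variable G : sgraph.
Implicit Type A : {set G}.

(* This also holds of the graph without vertices; a member of [in_W p] with
   [0 < p] has at least one vertex. *)
Definition connected_graph : Prop := forall x y : G, connect (@adj G) x y.

Definition independent A : bool :=
  [forall u in A, forall v in A, ~~ adj u v].

Definition alpha : nat := (\max_(A : {set G} | independent A) #|A|)%N.

Definition max_independent A : bool := independent A && (#|A| == alpha).

Definition open_nbhd A : {set G} :=
  [set v in ~: A | [exists u in A, adj u v]].

Definition disjoint_family (p : nat) (A : 'I_p -> {set G}) : Prop :=
  forall i j : 'I_p, i != j -> [disjoint A i & A j].

Definition in_W (p : nat) : Prop :=
  (p <= #|G|)%N /\
  forall A : 'I_p -> {set G},
    (forall i, independent (A i)) -> disjoint_family A ->
    exists S : 'I_p -> {set G},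
      [/\ forall i, max_independent (S i),
          disjoint_family S
        & forall i, A i \subset S i].

Definition quasi_regularizable (R : realType) (lambda : R) : Prop :=
  forall A, independent A -> lambda * #|A|%:R <= #|open_nbhd A|%:R.

Definition indep_count (k : nat) : nat :=
  #|[set A : {set G} | independent A & #|A| == k]|.

Definition indep_poly : {poly nat} := \poly_(k < alpha.+1) indep_count k.

Definition indep_poly_unimodal : Prop :=
  exists t : nat,
    [/\ (t <= alpha)%N,
        forall k : nat, (k < t)%N -> ((indep_poly`_k)%R <= (indep_poly`_k.+1)%R)%N
      & forall k : nat, (t <= k < alpha)%N ->
          ((indep_poly`_k.+1)%R <= (indep_poly`_k)%R)%N].

End Graph.

(* Main.v *)
Require Import Defs.
From HB Require Import structures.
From mathcomp Require Import all_boot all_order all_algebra.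
From mathcomp Require Import reals.
From mathcomp Require Import zify lra.

(** For an independent set [A], let [free A] be the set of vertices outside [A]
    that have no neighbour in [A]; these are exactly the vertices by which [A]
    can be enlarged.  Counting the pairs (independent set of size
    [k.+1], vertex in it) by the set with the vertex removed gives
    [(k + 1) s_(k+1) = \sum_A #|free A|], the sum running over the independent
    sets [A] of size [k] ([sum_card_free]).  So a uniform bound on [#|free A|]
    compares two consecutive coefficients ([indep_count_le_succ],
    [indep_count_succ_le]).

    In a graph of [W_p], [free A] contains [p] disjoint independent sets of
    size [alpha - k] ([in_W_free_packing]): grow them one at a time, each time
    applying the [W_p] property to the family in which the set to be grown is
    joined with [A].  Hence [#|free A| >= p (alpha - k)], which is at least
    [k + 1] as soon as [k <= (p alpha - 1) / (p + 1)]: the sequence increases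
    there.

    Quasi-regularizability gives [#|free A| <= n - (1 + lambda) k], which is
    at most [k + 1] as soon as [k >= (n - 1) / (lambda + 2)]: the sequence
    decreases there.  Finally [0 <= L + 1 <= alpha], so that [L + 1] is a mode
    when [R <= L + 1]. *)

Set Implicit Arguments.
Unset Strict Implicit.
Unset Printing Implicit Defensive.

Import Order.TTheory GRing.Theory Num.Theory.

Local Open Scope ring_scope.

Section FreeVertices.
Variable G : sgraph.
Implicit Types A B S : {set G}.

Definition free A : {set G} := ~: (A :|: open_nbhd A).

Lemma independentP A :
  reflect {in A &, forall u v, ~~ adj u v} (independent A).
Proof.
apply: (iffP forall_inP) => [indA u v uA vA | indA u uA].
  exact: (forall_inP (indA u uA)).
by apply/forall_inP => v; apply: indA.
Qed.

Lemma independent_set0 : independent (set0 : {set G}).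
Proof. by apply/independentP => u v; rewrite inE. Qed.

Lemma independentS A B : A \subset B -> independent B -> independent A.
Proof.
move=> /subsetP sAB /independentP indB.
by apply/independentP => u v /sAB uB /sAB vB; apply: indB.
Qed.

Lemma in_free A v :
  (v \in free A) = (v \notin A) && [forall u in A, ~~ adj u v].
Proof.
rewrite !inE negb_or; case: (v \in A) => //=.
by rewrite negb_exists; apply: eq_forallb => u; rewrite negb_and implybE.
Qed.

Lemma independentU_free A B :
  independent A -> independent B -> B \subset free A -> independent (A :|: B).
Proof.
move=> /independentP indA /independentP indB /subsetP sBF.
have AB u v : u \in A -> v \in B -> ~~ adj u v.
  move=> uA /sBF; rewrite in_free => /andP[_ /forall_inP]; exact.
apply/independentP => u v; rewrite !inE => /orP[uA|uB] /orP[vA|vB].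
- exact: indA.
- exact: AB.
- by rewrite adj_sym; apply: AB.
- exact: indB.
Qed.

Lemma independent_setD_free A S :
  independent S -> A \subset S -> S :\: A \subset free A.
Proof.
move=> /independentP indS /subsetP sAS; apply/subsetP => v.
rewrite inE in_free => /andP[-> vS] /=.
by apply/forall_inP => u /sAS uS; apply: indS.
Qed.

Lemma freeE A v :
  independent A -> (v \in free A) = (v \notin A) && independent (v |: A).
Proof.
move=> indA; apply/idP/andP => [vF | [vA indvA]].
  split; first by move: vF; rewrite in_free => /andP[].
  rewrite setUC; apply: independentU_free => //; last by rewrite sub1set.
  by apply/independentP => x y /set1P-> /set1P->; rewrite adj_irr.
apply: (subsetP (independent_setD_free indvA (subsetUr _ _))).
by rewrite !inE vA eqxx.
Qed.

Lemma card_free A : (#|free A| + #|A| + #|open_nbhd A| = #|G|)%N.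
Proof.
have AN0 : A :&: open_nbhd A = set0.
  by apply/setP => v; rewrite !inE; case: (v \in A).
rewrite -(cardsC (A :|: open_nbhd A)) cardsU AN0 cards0 subn0.
rewrite -/(free A); lia.
Qed.

(** Both sides count the pairs of an independent set of size [k.+1] and one of
    its vertices: removing the vertex yields an independent set [A] of size [k]
    together with an element of [free A], and adding it back undoes this. *)
Lemma sum_card_free k :
  (\sum_(A : {set G} | independent A && (#|A| == k)) #|free A| =
   k.+1 * indep_count G k.+1)%N.
Proof.
pose lvl j : pred {set G} := fun A => independent A && (#|A| == j).
have -> : (k.+1 * indep_count G k.+1 = \sum_(B | lvl k.+1 B) \sum_(v in B) 1)%N.
  rewrite (eq_bigr (fun _ => k.+1)); last first.
    by move=> B /andP[_ /eqP cB]; rewrite sum1_card.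
  rewrite sum_nat_const mulnC /indep_count cardsE; congr (_ * _)%N.
rewrite (eq_bigr (fun A => \sum_(v in free A) 1)%N); last first.
  by move=> A _; rewrite sum1_card.
rewrite !pair_big_dep /=.
rewrite (reindex_onto (fun q : {set G} * G => (q.1 :\ q.2, q.2))
                      (fun q : {set G} * G => (q.2 |: q.1, q.2))) /=; last first.
  move=> [A v] /= /andP[/andP[indA _]]; rewrite freeE // => /andP[vA _].
  by rewrite setU1K.
apply: eq_bigl => -[B v] /=; rewrite /lvl xpair_eqE eqxx andbT.
case: (boolP (v \in B)) => vB; last first.
  rewrite andbF; apply/negP => /andP[_ /eqP eB].
  by move: vB; rewrite -eB setU11.
rewrite setD1K // eqxx !andbT (cardsD1 v B) vB add1n eqSS.
case: (boolP (independent B)) => indB.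
  by rewrite (independentS (subD1set _ _) indB) freeE ?(independentS (subD1set _ _) indB) //
             setD1K // indB setD11 /= andbT.
apply/negP => /andP[/andP[indBv _]]; rewrite freeE // setD1K //.
by rewrite (negbTE indB) andbF.
Qed.

Lemma indep_count_le_succ k :
  (forall A, independent A -> #|A| = k -> (k < #|free A|)%N) ->
  (indep_count G k <= indep_count G k.+1)%N.
Proof.
move=> lbF; rewrite -(leq_pmul2l (ltn0Sn k)) -sum_card_free.
rewrite mulnC /indep_count cardsE -sum_nat_const.
by apply: leq_sum => A /andP[indA /eqP cA]; apply: lbF.
Qed.

Lemma indep_count_succ_le k :
  (forall A, independent A -> #|A| = k -> (#|free A| <= k.+1)%N) ->
  (indep_count G k.+1 <= indep_count G k)%N.
Proof.
move=> ubF; rewrite -(leq_pmul2l (ltn0Sn k)) -sum_card_free.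
rewrite [leqRHS]mulnC /indep_count cardsE -sum_nat_const.
by apply: leq_sum => A /andP[indA /eqP cA]; apply: ubF.
Qed.

(** The index [m] counts the sets already grown to the size [alpha - #|A|].
    Maximum independent sets containing [A] are never disjoint when [A] is
    nonempty, so [W_p] cannot grow all the sets at once.  Instead, the [m]-th
    set is joined with [A], the family is extended to disjoint maximum
    independent sets, and only the [m]-th set is replaced, by its extension
    minus [A].  The other sets lie in their own extensions, hence remain
    disjoint from the new one. *)
Lemma in_W_free_packing p A m :
  in_W G p -> independent A -> (m <= p)%N ->
  exists B : 'I_p -> {set G},
    [/\ forall i, independent (B i), disjoint_family B,
        forall i, B i \subset free A
      & forall i : 'I_p, (i < m)%N -> #|B i| = (alpha G - #|A|)%N].
Proof.
move=> [_ WG] indA; elim: m => [|m IHm] lmp.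
  exists (fun=> set0); split=> // [_|i j _|i]; first exact: independent_set0.
    by rewrite disjoints_subset sub0set.
  exact: sub0set.
have [B [indB dB sBF cB]] := IHm (ltnW lmp).
pose i0 := Ordinal lmp.
have dUB i : i != i0 -> [disjoint A :|: B i0 & B i].
  rewrite eq_sym => ni0.
  rewrite -setI_eq0 setIUl setU_eq0 !setI_eq0 dB // andbT.
  rewrite disjoint_sym disjoints_subset.
  by apply: subset_trans (sBF i) _; rewrite /free setCS subsetUl.
pose C i := if i == i0 then A :|: B i0 else B i.
have [||S [maxS dS sCS]] := WG C.
- move=> i; rewrite /C; case: eqP => // _.
  exact: independentU_free.
- move=> i j nij; rewrite /C.
  case: eqP => [ei|/eqP ni0]; case: eqP => [ej|/eqP nj0].
  + by rewrite ei ej eqxx in nij.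
  + exact: dUB.
  + by rewrite disjoint_sym; apply: dUB.
  + exact: dB.
have sAS : A \subset S i0.
  by apply: subset_trans (sCS i0); rewrite /C eqxx subsetUl.
have sBS i : i != i0 -> B i \subset S i.
  by move=> ni0; move: (sCS i); rewrite /C (negbTE ni0).
have /andP[indS /eqP cS] := maxS i0.
have dSB i : i != i0 -> [disjoint S i0 :\: A & B i].
  move=> ni0; apply: disjointWl (subsetDl _ _) _.
  by apply: disjointWr (sBS i ni0) _; apply: dS; rewrite eq_sym.
exists (fun i => if i == i0 then S i0 :\: A else B i); split.
- move=> i; case: eqP => // _; exact: independentS (subsetDl _ _) indS.
- move=> i j nij; case: eqP => [ei|/eqP ni0]; case: eqP => [ej|/eqP nj0].
  + by rewrite ei ej eqxx in nij.
  + exact: dSB.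
  + by rewrite disjoint_sym; apply: dSB.
  + exact: dB.
- move=> i; case: eqP => // _; exact: independent_setD_free.
- move=> i lim; case: eqP => [_|/eqP ni0].
    by rewrite cardsD (setIidPr sAS) cS.
  by apply: cB; move: ni0; rewrite -val_eqE /=; lia.
Qed.

Lemma in_W_card_free p A :
  in_W G p -> independent A -> (p * (alpha G - #|A|) <= #|free A|)%N.
Proof.
move=> WG indA; have [B [_ dB sBF cB]] := in_W_free_packing WG indA (leqnn p).
have -> : (p * (alpha G - #|A|) = #|\bigcup_i B i|)%N.
  rewrite -[RHS]sum1_card (partition_disjoint_bigcup _ _ dB).
  under eq_bigr => i _ do rewrite sum1_card cB //.
  by rewrite sum_nat_const card_ord.
by apply: subset_leq_card; apply/bigcupsP.
Qed.

Lemma quasi_regularizable_card_free (R : realType) (lambda : R) A :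
  quasi_regularizable G lambda -> independent A ->
  #|free A|%:R <= #|G|%:R - (1 + lambda) * #|A|%:R.
Proof.
move=> qrG /qrG; rewrite -(card_free A) !natrD; lra.
Qed.

Lemma coef_indep_poly k :
  (k <= alpha G)%N -> (indep_poly G)`_k = indep_count G k.
Proof. by move=> lka; rewrite coef_poly ltnS lka. Qed.

End FreeVertices.

Theorem theorem3p4 (R : realType) (p : nat) (lambda : R) (G : sgraph)
  (p_ge1 : (1 <= p)%N) (lambda_gt0 : 0 < lambda)
  (G_conn : connected_graph G) (G_W : in_W G p)
  (G_qr : quasi_regularizable G lambda) :
  let n : nat := #|G| in
  let a : nat := alpha G in
  let s : nat -> nat := fun k => (indep_poly G)`_k in
  let Lidx : int := Num.floor ((p%:R * a%:R - 1) / (p%:R + 1) : R) in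
  let Ridx : int := Num.ceil ((n%:R - 1) / (lambda + 2)) in
  [/\ forall k : nat, k%:Z < Lidx + 1 -> (s k <= s k.+1)%N,
      forall k : nat, Ridx <= k%:Z -> (k < a)%N -> (s k.+1 <= s k)%N
    & Ridx <= Lidx + 1 -> indep_poly_unimodal G].
Proof.
move=> n a s Lidx Ridx.
have p1_gt0 : 0 < p%:R + 1 :> R by rewrite ltr_wpDl.
have l2_gt0 : 0 < lambda + 2 by rewrite addr_gt0.
(* Both floor and ceiling disappear once the bounds are multiplied out. *)
have le_L k : (k%:Z < Lidx + 1) = ((p + 1) * k + 1 <= p * a)%N.
  rewrite ltzD1 floor_ge_int ler_pdivlMr //.
  rewrite lerBrDr -[in RHS](ler_nat R) !natrD !natrM natrD.
  by rewrite mulrC.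
have R_le k : (Ridx <= k%:Z) = (n%:R <= (lambda + 2) * k%:R + 1).
  by rewrite ceil_le_int ler_pdivrMr // lerBlDr mulrC.
have incr k : k%:Z < Lidx + 1 -> (s k <= s k.+1)%N.
  rewrite le_L => hk.
  have lka : (k < a)%N by nia.
  rewrite /s !coef_indep_poly ?(ltnW lka) //.
  apply: indep_count_le_succ => A indA cA.
  apply: leq_trans (in_W_card_free G_W indA).
  by rewrite cA -/a mulnBr; nia.
have decr k : Ridx <= k%:Z -> (k < a)%N -> (s k.+1 <= s k)%N.
  rewrite R_le => hk lka; rewrite /s !coef_indep_poly ?(ltnW lka) //.
  apply: indep_count_succ_le => A indA cA.
  rewrite -(ler_nat R) -natr1.
  apply: le_trans (quasi_regularizable_card_free G_qr indA) _.
  by rewrite cA -/n; nra.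
split=> // leRL.
(* The bounds [- 1 <= (p a - 1) / (p + 1) < a] make [L + 1] a legal index. *)
have L1_ge0 : 0 <= Lidx + 1.
  rewrite -[leLHS](addNr 1) lerD2r floor_ge_int mulrN1z ler_pdivlMr //.
  have := mulr_ge0 (ler0n R p) (ler0n R a); have := ler0n R p; lra.
have L1_le : Lidx + 1 <= a%:Z.
  by rewrite leNgt le_L; lia.
exists (absz (Lidx + 1)); split.
- by lia.
- by move=> k hk; apply: incr; lia.
- by move=> k /andP[hk lka]; apply: decr lka; apply: le_trans leRL _; lia.
Qed.
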